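(* Let $G=\mathrm{Sl}(2,\mathbb{R})$. Then the map $$NA\times\Omega\times\Lambda\to \mathrm{Cr}(X),\qquad (na,H,Y)\mapsto na\exp(iH)\exp(iY)\cdot x_0$$ is an $NA$-equivariant diffeomorphism (where $NA$ acts on the source by left multiplication on the first factor, and on $\mathrm{Cr}(X)$ by the restriction of the $G_\mathbb{C}$-action on $X_\mathbb{C}$).
   Context: Let $G=\mathrm{Sl}(2,\mathbb{R})$, $G_\mathbb{C}=\mathrm{Sl}(2,\mathbb{C})$, $K=\mathrm{SO}(2,\mathbb{R})$, $K_\mathbb{C}=\mathrm{SO}(2,\mathbb{C})$, $$A=\left\{\begin{pmatrix} t&0\\0&1/t\end{pmatrix}: t>0\right\},\qquad N=\left\{\begin{pmatrix}1&x\\0&1\end{pmatrix}: x\in\mathbb{R}\right\}.$$ Let $X=G/K\hookrightarrow X_\mathbb{C}=G_\mathbb{C}/K_\mathbb{C}$, $gK\mapsto gK_\mathbb{C}$, with base point $x_0=K_\mathbb{C}$. Set $$\Omega=\left\{\begin{pmatrix}x&0\\0&-x\end{pmatrix}: x\in(-\pi/4,\pi/4)\right\},\qquad \Lambda=\left\{\begin{pmatrix}0&x\\0&0\end{pmatrix}: x\in(-1,1)\right\}.$$ The crown domain of $X$ is $\mathrm{Cr}(X)=G\exp(i\Omega)\cdot x_0\subset X_\mathbb{C}$. Equivalently: $X_\mathbb{C}$ is identified $G_\mathbb{C}$-equivariantly with $(\mathbb{P}^1(\mathbb{C})\times\mathbb{P}^1(\mathbb{C}))\setminus\mathrm{diag}$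 via $gK_\mathbb{C}\mapsto (g(i),g(-i))$ (fractional linear action), and under this identification $\mathrm{Cr}(X)$ is the product of the open upper half plane and the open lower half plane. *)

(* Defs.v *)
From HB Require Import structures.
From mathcomp Require Import all_boot all_order all_algebra.
From mathcomp Require Import all_classical all_reals all_analysis.
From mathcomp Require Import complex.

Set Implicit Arguments.
Unset Strict Implicit.
Unset Printing Implicit Defensive.

Import Order.TTheory GRing.Theory Num.Theory.
Import numFieldNormedType.Exports.

Local Open Scope classical_set_scope.
Local Open Scope complex_scope.
Local Open Scope ring_scope.

(* C^k on an open set U.  V is meant to be finite-dimensional: continuity of
   all directional derivatives is then continuity of the Frechet derivative. *)
Fixpoint Ck_on (R : realType) (V W : normedModType R) (k : nat) (U : set V)
    (f : V -> W) : Prop :=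
  match k with
  | 0 => forall x, U x -> {for x, continuous f}
  | k'.+1 => (forall x, U x -> differentiable f x) /\
             (forall v : V, Ck_on k' U ('D_v f))
  end.

Definition smooth_on (R : realType) (V W : normedModType R) (U : set V)
    (f : V -> W) : Prop := forall k, Ck_on k U f.

(* A manifold is presented by its topology and its sheaf of smooth real
   functions: [smooth_fun M U f] says that f is smooth on the open set U (the
   values of f outside U are irrelevant).  Smooth maps are the continuous maps
   that pull local smooth functions back to local smooth functions. *)
Record smooth_space (R : realType) (T : Type) := SmoothSpace {
  carrier : set T;
  smooth_open : set T -> Prop;
  smooth_fun : set T -> (T -> R) -> Prop }.

Definition smooth_map (R : realType) (T T' : Type) (M : smooth_space R T)
    (N : smooth_space R T') (F : T -> T') : Prop :=
  (forall x, carrier M x -> carrier N (F x)) /\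
  (forall V, smooth_open N V ->
     smooth_open M (carrier M `&` F @^-1` V) /\
     (forall f, smooth_fun N V f ->
        smooth_fun M (carrier M `&` F @^-1` V) (f \o F))).

Definition diffeomorphism (R : realType) (T T' : Type) (M : smooth_space R T)
    (N : smooth_space R T') (F : T -> T') : Prop :=
  exists F' : T' -> T,
    [/\ smooth_map M N F, smooth_map N M F',
        (forall x, carrier M x -> F' (F x) = x) &
        (forall y, carrier N y -> F (F' y) = y)].

(* The submanifold structure on S induced by an injection e into a normed
   space: subspace topology, and smooth functions are those that locally
   extend to smooth functions on the ambient space. *)
Definition embedded (R : realType) (V : normedModType R) (T : Type)
    (e : T -> V) (S : set T) : smooth_space R T :=
  SmoothSpace S
    (fun U => exists2 O : set V, open O & U = S `&` e @^-1` O)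
    (fun U f => forall x, U x -> exists (O : set V) (g : V -> R^o),
       [/\ open O, O (e x), smooth_on O g &
           forall y, U y -> O (e y) -> f y = g (e y)]).

(* The quotient structure along p: for a Lie group modulo a closed subgroup it
   is the unique one making the projection p a submersion. *)
Definition quotient_space (R : realType) (T T' : Type) (M : smooth_space R T)
    (p : T -> T') : smooth_space R T' :=
  SmoothSpace (p @` carrier M)
    (fun V => V `<=` p @` carrier M /\ smooth_open M (carrier M `&` p @^-1` V))
    (fun V f => smooth_fun M (carrier M `&` p @^-1` V) (f \o p)).

(* For D open in M. *)
Definition open_subspace (R : realType) (T : Type) (M : smooth_space R T)
    (D : set T) : smooth_space R T :=
  SmoothSpace D (fun U => U `<=` D /\ smooth_open M U) (smooth_fun M).

Definition equivariant (S T T' : Type) (G : set S) (D : set T) (D' : set T')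
    (act : S -> T -> T) (act' : S -> T' -> T') (F : T -> T') : Prop :=
  forall g x, G g -> D x ->
    [/\ D (act g x), D' (act' g (F x)) & F (act g x) = act' g (F x)].

Definition mx2 (T : Type) (a b c d : T) : 'M[T]_2 :=
  \matrix_(i, j) if i == ord0 then (if j == ord0 then a else b)
                 else (if j == ord0 then c else d).

(* exp Z = \sum_k Z^k / k!, the limit being taken entrywise, separately on
   real and imaginary parts. *)
Definition mexp_partial (R : realType) (m : nat) (Z : 'M[R[i]]_m.+1)
    (n : nat) : 'M[R[i]]_m.+1 :=
  \sum_(k < n) (k`!%:R)^-1 *: Z ^+ k.

Definition mexp (R : realType) (m : nat) (Z : 'M[R[i]]_m.+1) : 'M[R[i]]_m.+1 :=
  \matrix_(i, j) (limn (fun n => complex.Re (mexp_partial Z n i j)) +i*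
                  limn (fun n => complex.Im (mexp_partial Z n i j))).

Section Crown.
Variable R : realType.

Definition SL2R : set 'M[R]_2 := [set g | \det g = 1].
Definition SL2C : set 'M[R[i]]_2 := [set g | \det g = 1].
Definition SO2C : set 'M[R[i]]_2 := [set k | k^T *m k = 1%:M /\ \det k = 1].

Definition subgroupA : set 'M[R]_2 := [set mx2 t 0 0 t^-1 | t in [set t : R | 0 < t]].
Definition subgroupN : set 'M[R]_2 := [set mx2 1 x 0 1 | x in [set: R]].
Definition subgroupNA : set 'M[R]_2 := [set n *m a | n in subgroupN & a in subgroupA].

Definition Omega : set 'M[R]_2 :=
  [set mx2 x 0 0 (- x) | x in [set x : R | - (pi / 4) < x < pi / 4]].
Definition Lambda : set 'M[R]_2 :=
  [set mx2 0 x 0 0 | x in [set x : R | -1 < x < 1]].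

Definition cplx (B : 'M[R]_2) : 'M[R[i]]_2 := map_mx (real_complex R) B.

Definition expi (B : 'M[R]_2) : 'M[R[i]]_2 := mexp ((0 +i* 1) *: cplx B).

(* Points of X_C = SL(2,C)/SO(2,C) are left cosets g K_C, as sets of matrices;
   [actC g x] is the translate g . x. *)
Definition actC (g : 'M[R[i]]_2) (x : set 'M[R[i]]_2) : set 'M[R[i]]_2 :=
  [set g *m z | z in x].
Definition x0 : set 'M[R[i]]_2 := SO2C.

Definition realify (Z : 'M[R[i]]_2) : 'M[R]_2 * 'M[R]_2 :=
  (map_mx (@complex.Re R) Z, map_mx (@complex.Im R) Z).

Definition XC : smooth_space R (set 'M[R[i]]_2) :=
  quotient_space (embedded realify SL2C) (fun g => actC g x0).

Definition crown : set (set 'M[R[i]]_2) :=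
  [set actC (cplx g *m expi H) x0 | g in SL2R & H in Omega].

Definition crown_space : smooth_space R (set 'M[R[i]]_2) :=
  open_subspace XC crown.

Definition parameters : set ('M[R]_2 * 'M[R]_2 * 'M[R]_2) :=
  subgroupNA `*` Omega `*` Lambda.

Definition parameter_space : smooth_space R ('M[R]_2 * 'M[R]_2 * 'M[R]_2) :=
  embedded id parameters.

Definition crown_map (p : 'M[R]_2 * 'M[R]_2 * 'M[R]_2) : set 'M[R[i]]_2 :=
  actC (cplx p.1.1 *m expi p.1.2 *m expi p.2) x0.

Definition act_parameters (b : 'M[R]_2) (p : 'M[R]_2 * 'M[R]_2 * 'M[R]_2) :
    'M[R]_2 * 'M[R]_2 * 'M[R]_2 :=
  (b *m p.1.1, p.1.2, p.2).

Definition act_crown (b : 'M[R]_2) (x : set 'M[R[i]]_2) : set 'M[R[i]]_2 :=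
  actC (cplx b) x.

End Crown.

(* Main.v *)
Require Import Defs.
From HB Require Import structures.
From mathcomp Require Import all_boot all_order all_algebra.
From mathcomp Require Import all_classical all_reals all_analysis.
From mathcomp Require Import complex ring lra.

(** The proof replaces a coset g K_C by the complex symmetric matrix g g^T,
which determines it: for g and h of determinant one, g g^T = h h^T says exactly
that h^-1 g is orthogonal (eq_coset).  Since det (g g^T) = 1, that matrix is in
turn determined by its two entries r = (g g^T)_11 and q = (g g^T)_01 as soon as
r != 0 (gram_eq).

For b = ((t, x/t), (0, 1/t)) in NA, H = diag(th, - th) and Y = ((0, y), (0, 0)),
the point b exp(iH) exp(iY) K_C has
   r = exp(- 2 i th) / t^2   and   q = i y + x r.
These equations can be solved by explicit formulas when Re r > 0:
   t = |r|^(-1/2),  th = - arg(r) / 2,  x = Re q / Re r,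
   y = Im q - Re q Im r / Re r
(horo_coord, horo_coord_gram, gram_horo_coord).  They give the inverse map, once
the crown is known to be the set of cosets with Re r > 0 and |y| < 1 (crownP).

A point g exp(iH) K_C with g real has the symmetric matrix
g diag(exp(2 i th), exp(- 2 i th)) g^T, for which
y = 2 c d sin(2 th) / (c^2 + d^2) with (c, d) the bottom row of g, so that
|y| <= |sin(2 th)| < 1 (crown_gram).  Conversely, the symmetric matrix of
exp(iH) exp(iY) K_C has a positive definite real part; after a real diagonal
change of basis the real part is scalar, the imaginary part is symmetric of
trace zero, and a rotation diagonalizes both, which puts the point in
G exp(i Omega) x_0 (diagonalize_symmetric, crown_map_in_crown).

For smoothness, both the map and its inverse are induced by maps between vector
spaces of matrices whose entries are built from polynomials, cos, sin, atan,
square roots and inverses: a lift of the map to SL(2,C) in one direction, and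
the formulas above as functions of g in the other.  The general facts
smooth_map_lift and smooth_map_descend reduce smoothness for the quotient
structure to smoothness of these maps, and rest on the chain rule Ck_comp. *)

Set Implicit Arguments.
Unset Strict Implicit.
Unset Printing Implicit Defensive.

Import Order.TTheory GRing.Theory Num.Theory.
Import numFieldNormedType.Exports.

Local Open Scope classical_set_scope.
Local Open Scope complex_scope.
Local Open Scope ring_scope.

(** * Calculus of C^k maps *)

Section Smoothness.
Context {R : realType}.
Implicit Types V W : normedModType R.

(** g - f vanishes near x, hence is differentiable there with differential 0. *)
Lemma near_eq_differentiable V W (f g : V -> W) (x : V) :
  (\near x, f x = g x) -> differentiable f x -> differentiable g x.
Proof.
move=> fg df.
suff dgf : differentiable (fun y => g y - f y) x.
  have -> : g = f + (fun y => g y - f y).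
    by apply/funext => y; rewrite !fctE addrC subrK.
  exact: differentiableD.
have gfx : g x - f x = 0 by rewrite (nbhs_singleton fg) subrr.
have gf0 : (fun y => g y - f y) \o shift x =
    cst (g x - f x) + (\0 : {linear V -> W}) +o_ 0 id.
  apply/eqaddoP => e e0.
  have : \forall y \near 0, f (y + x) = g (y + x).
    have := fg; rewrite (near_shift 0)/=.
    by apply: filterS => y; rewrite /= subr0.
  apply: filterS => y /= fgy; rewrite !fctE /= fgy gfx !subrr addr0 subrr.
  by rewrite normr0; apply: mulr_ge0 => //; exact: (ltW e0).
apply/diff_locallyP.
rewrite (@diff_unique _ _ _ _ (\0 : {linear V -> W}) _ _ gf0); last first.
  exact: cst_continuous.
by split => //; exact: cst_continuous.
Qed.

Lemma Ck_sub V W k (U U' : set V) (f : V -> W) :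
  U `<=` U' -> Ck_on k U' f -> Ck_on k U f.
Proof.
move=> sUU'; elim: k f => [|k IH] f /= Hf; first by move=> x /sUU'; exact: Hf.
by case: Hf => Hd HD; split=> [x /sUU'|v]; [exact: Hd|exact: IH].
Qed.

(** Openness of U matters: derivatives at a point of U see a whole
    neighbourhood of it. *)
Lemma Ck_ext V W k (U : set V) (f g : V -> W) : open U ->
  (forall x, U x -> f x = g x) -> Ck_on k U f -> Ck_on k U g.
Proof.
move=> oU; elim: k f g => [|k IH] f g fg /=.
  move=> Hf x Ux; have /near_eq_cvg fgx : \near x, f x = g x.
    by apply: (filterS fg); exact: open_nbhs_nbhs.
  suff : g @ x --> f x by rewrite fg.
  apply: cvg_trans (Hf x Ux).
  exact: fgx.
have fgx x : U x -> \near x, f x = g x.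
  by move=> Ux; apply: (filterS fg); exact: open_nbhs_nbhs.
move=> [Hd HD]; split=> [x Ux|v].
  by apply: near_eq_differentiable (Hd x Ux); exact: fgx.
apply: IH (HD v) => x Ux.
by apply: near_eq_derive; exact: fgx.
Qed.

Lemma CkS V W k (U : set V) (f : V -> W) : Ck_on k.+1 U f -> Ck_on k U f.
Proof.
elim: k f => [|k IH] f /= [Hd HD].
  by move=> x Ux; exact/differentiable_continuous/Hd.
by split=> // v; exact/IH/HD.
Qed.

Lemma Ck_cst V W k (U : set V) (c : W) : Ck_on k U (fun=> c).
Proof.
elim: k c => [|k IH] c /=; first by move=> x _; exact: cst_continuous.
split=> [x _|v]; first exact: differentiable_cst.
rewrite (_ : 'D_v _ = fun=> 0); last by apply/funext=> x; exact: derive_cst.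
exact: IH.
Qed.

Lemma Ck_linear V W k (U : set V) (f : {linear V -> W}) :
  continuous f -> Ck_on k U f.
Proof.
move=> cf; case: k => [|k] /=; first by move=> x _; exact: cf.
split=> [x _|v]; first exact: linear_differentiable.
rewrite (_ : 'D_v _ = fun=> f v); first exact: Ck_cst.
apply/funext=> x; rewrite deriveE ?diff_lin //; exact: linear_differentiable.
Qed.

Lemma CkD V W k (U : set V) (f g : V -> W) : open U ->
  Ck_on k U f -> Ck_on k U g -> Ck_on k U (fun x => f x + g x).
Proof.
move=> oU; elim: k f g => [|k IH] f g /=.
  by move=> Hf Hg x Ux; apply: continuousD; [exact: Hf|exact: Hg].
move=> [df Df] [dg Dg]; split=> [x Ux|v].
  by apply: differentiableD; [exact: df|exact: dg].
apply: (Ck_ext oU _ (IH _ _ (Df v) (Dg v))) => x Ux /=.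
by rewrite deriveD //; apply: diff_derivable; [exact: df|exact: dg].
Qed.

Lemma Ck_sum V W k (U : set V) (I : Type) (s : seq I) (f : I -> V -> W) :
  open U -> (forall i, Ck_on k U (f i)) ->
  Ck_on k U (fun x => \sum_(i <- s) f i x).
Proof.
move=> oU Hf; elim: s => [|i s IH].
  apply: (Ck_ext oU _ (Ck_cst k U 0)) => x _; by rewrite big_nil.
by apply: (Ck_ext oU _ (CkD oU (Hf i) IH)) => x _; rewrite big_cons.
Qed.

Lemma CkM V k (U : set V) (f g : V -> R^o) : open U ->
  Ck_on k U f -> Ck_on k U g -> Ck_on k U (fun x => f x * g x : R^o).
Proof.
move=> oU; elim: k f g => [|k IH] f g.
  move=> Hf Hg x Ux; apply: (@continuousM R V f g); [exact: Hf|exact: Hg].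
move=> Hf Hg; have [df Df] := Hf; have [dg Dg] := Hg; split=> [x Ux|v].
  by apply: (@differentiableM R V f g); [exact: df|exact: dg].
apply: (Ck_ext oU _ (CkD oU (IH _ _ (CkS Hf) (Dg v)) (IH _ _ (CkS Hg) (Df v)))).
by move=> x Ux /=; rewrite (@deriveM R V f g) //; apply: diff_derivable;
  [exact: df|exact: dg].
Qed.

Lemma CkZl V W k (U : set V) (f : V -> R^o) (w : W) : open U ->
  Ck_on k U f -> Ck_on k U (fun x => f x *: w).
Proof.
move=> oU; elim: k f => [|k IH] f /=.
  by move=> Hf x Ux; apply: cvgZr_tmp; exact: Hf.
move=> [df Df]; split=> [x Ux|v]; first exact/differentiableZl/df.
apply: (Ck_ext oU _ (IH _ (Df v))) => x Ux.
rewrite (deriveE _ (df x Ux)) [RHS]deriveE; last exact/differentiableZl/df.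
by rewrite diffZl //; exact: df.
Qed.

(** A finite spanning family with a choice of coefficients: maps into W are
    handled through their scalar components. *)
Definition coordinates (I : finType) W (e : I -> W) (c : I -> W -> R) :=
  forall w, w = \sum_i c i w *: e i.

Lemma is_diff_frame V W (I : Type) (s : seq I) (e : I -> W) (f : I -> V -> R^o)
    (x : V) : (forall i, differentiable (f i) x) ->
  is_diff x (fun y => \sum_(i <- s) f i y *: e i)
            (fun v => \sum_(i <- s) 'd (f i) x v *: e i).
Proof.
move=> df; elim: s => [|i s IH].
  have -> : (fun y : V => \sum_(i <- [::]) f i y *: e i) = cst 0.
    by apply/funext=> y; rewrite big_nil.
  have -> : (fun v : V => \sum_(i <- [::]) 'd (f i) x v *: e i) = 0.
    by apply/funext=> y; rewrite big_nil.
  exact: is_diff_cst.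
have -> : (fun y : V => \sum_(j <- i :: s) f j y *: e j) =
    (fun y => f i y *: e i) + (fun y => \sum_(j <- s) f j y *: e j).
  by apply/funext=> y; rewrite big_cons.
have -> : (fun v : V => \sum_(j <- i :: s) 'd (f j) x v *: e j) =
    (fun v => 'd (f i) x v *: e i) +
    (fun v => \sum_(j <- s) 'd (f j) x v *: e j).
  by apply/funext=> y; rewrite big_cons.
apply: is_diffD; apply: DiffDef; first exact: differentiableZl.
exact: diffZl.
Qed.

Lemma Ck_coordinates V W (I : finType) (e : I -> W) (c : I -> W -> R^o) k
    (U : set V) (f : V -> W) : coordinates e c -> open U ->
  (forall i, Ck_on k U (c i \o f)) -> Ck_on k U f.
Proof.
move=> ec oU Hf.
have -> : f = fun y => \sum_i (c i \o f) y *: e i.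
  by apply/funext=> y; exact: ec.
by apply: Ck_sum => // i; exact: CkZl.
Qed.

(** The chain rule D_v (g o f) = sum_i D_v (c_i o f) * (D_(e_i) g) o f writes
    the derivative of the composite with components of f and the fixed
    directional derivatives of g.  The finite expansion is what makes the
    induction work: the direction D_v f itself varies with the point, whereas
    C^k regularity only speaks of derivatives in constant directions. *)
Lemma Ck_comp V W (I : finType) (e : I -> W) (c : I -> W -> R^o) k
    (U : set V) (U' : set W) (f : V -> W) (g : W -> R^o) :
  coordinates e c -> open U -> (forall x, U x -> U' (f x)) ->
  (forall i, Ck_on k U (c i \o f)) -> Ck_on k U' g -> Ck_on k U (g \o f).
Proof.
move=> ec oU UU'.
have fE : f = fun y => \sum_i (c i \o f) y *: e i.
  by apply/funext=> y; exact: ec.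
elim: k g => [|k IH] g Hf Hg.
  move=> x Ux; apply: continuous_comp; last exact/Hg/UU'.
  exact: (Ck_coordinates ec oU Hf).
have [dg Dg] := Hg.
have df x : U x -> is_diff x f (fun v => \sum_i 'd (c i \o f) x v *: e i).
  move=> Ux; rewrite {1}fE; apply: is_diff_frame => i.
  by have [+ _] := Hf i; exact.
split=> [x Ux|v].
  have ? := df x Ux; apply: differentiable_comp => //; exact/dg/UU'.
apply: (@Ck_ext _ _ _ _
  (fun x => \sum_i ('D_v (c i \o f) x * ('D_(e i) g \o f) x : R^o))) => //.
  move=> x Ux; have dfx := df x Ux; have dgx := dg _ (UU' _ Ux).
  rewrite [RHS]deriveE; last exact: differentiable_comp.
  rewrite diff_comp //= diff_val linear_sum; apply: eq_bigr => i _.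
  rewrite linearZ /= (deriveE _ dgx) deriveE //.
  by have [+ _] := Hf i; exact.
apply: Ck_sum => // i; apply: CkM => //; first by have [_] := Hf i; exact.
by apply: IH (Dg _) => j; exact: CkS.
Qed.
End Smoothness.

(** * Smooth functions of one and several variables *)

Section Smooth.
Context {R : realType}.
Implicit Types V W : normedModType R.

Lemma coordinates_scalar : coordinates (fun=> 1 : R^o) (fun _ : unit => id).
Proof.
by move=> w; rewrite big_const card_unit /= addr0 /GRing.scale /= mulr1.
Qed.

Definition mx_coord m n (i : 'I_m.+1 * 'I_n.+1)
    (w : 'M[R]_(m.+1, n.+1)) : R^o := w i.1 i.2.

Lemma coordinates_mx m n : coordinates
  (fun i : 'I_m.+1 * 'I_n.+1 => delta_mx i.1 i.2) (@mx_coord m n).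
Proof.
by move=> w; rewrite {1}(matrix_sum_delta w) pair_big; apply: eq_bigr => -[].
Qed.

Definition pair_basis (I J : finType) V W (e : I -> V) (e' : J -> W)
    (k : I + J) : V * W :=
  match k with inl i => (e i, 0) | inr j => (0, e' j) end.

Definition pair_coord (I J : finType) V W (c : I -> V -> R^o)
    (c' : J -> W -> R^o) (k : I + J) (w : V * W) : R^o :=
  match k with inl i => c i w.1 | inr j => c' j w.2 end.

Lemma coordinates_pair (I J : finType) V W
    (e : I -> V) (c : I -> V -> R^o) (e' : J -> W) (c' : J -> W -> R^o) :
  coordinates e c -> coordinates e' c' ->
  coordinates (pair_basis e e') (pair_coord c c').
Proof.
move=> ec ec' [v w]; rewrite big_sumType /= {1}(ec v) {1}(ec' w).
have lV (s : seq I) : \sum_(i <- s) c i v *: (e i, 0 : W) =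
    (\sum_(i <- s) c i v *: e i, 0).
  elim: s => [|i s IH]; first by rewrite !big_nil.
  by rewrite !big_cons IH; congr pair; rewrite /= scaler0 addr0.
have lW (s : seq J) : \sum_(i <- s) c' i w *: (0 : V, e' i) =
    (0, \sum_(i <- s) c' i w *: e' i).
  elim: s => [|i s IH]; first by rewrite !big_nil.
  by rewrite !big_cons IH; congr pair; rewrite /= scaler0 addr0.
by rewrite lV lW; congr pair; rewrite /= ?addr0 ?add0r.
Qed.

Lemma smooth_cst V W (U : set V) (w : W) : smooth_on U (fun=> w).
Proof. by move=> k; exact: Ck_cst. Qed.

Lemma smooth_linear V W (U : set V) (f : {linear V -> W}) :
  continuous f -> smooth_on U f.
Proof. by move=> cf k; exact: Ck_linear. Qed.

Section OpenDomain.
Variables (V : normedModType R) (U : set V).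
Hypothesis oU : open U.
Implicit Types f g : V -> R^o.

Lemma smoothD f g :
  smooth_on U f -> smooth_on U g -> smooth_on U (fun x => f x + g x : R^o).
Proof. by move=> sf sg k; exact: CkD. Qed.

Lemma smoothM f g :
  smooth_on U f -> smooth_on U g -> smooth_on U (fun x => f x * g x : R^o).
Proof. by move=> sf sg k; exact: CkM. Qed.

Lemma smoothN f : smooth_on U f -> smooth_on U (fun x => - f x : R^o).
Proof.
move=> sf; have := smoothM (smooth_cst U (-1 : R^o)) sf.
by congr smooth_on; apply/funext=> x; rewrite mulN1r.
Qed.

Lemma smoothB f g :
  smooth_on U f -> smooth_on U g -> smooth_on U (fun x => f x - g x : R^o).
Proof. by move=> sf sg; apply: smoothD => //; exact: smoothN. Qed.

Lemma smooth_comp1 (U' : set R^o) (h : R^o -> R^o) f : smooth_on U' h ->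
  (forall x, U x -> U' (f x)) -> smooth_on U f -> smooth_on U (h \o f).
Proof.
move=> sh UU' sf k.
exact: (Ck_comp coordinates_scalar oU UU' (fun=> sf k) (sh k)).
Qed.
End OpenDomain.

(** Raises the order of regularity by one for functions of one variable known
    through an equation for their derivative. *)
Lemma CkS_derive1 k (U : set R^o) (h h' : R^o -> R^o) : open U ->
  (forall x, U x -> is_derive (x : R^o) (1 : R^o) h (h' x)) ->
  Ck_on k U h' -> Ck_on k.+1 U h.
Proof.
move=> oU hh' Ch'.
have dh x : U x -> differentiable h x.
  by move=> Ux; apply/derivable1_diffP; case: (hh' x Ux).
split=> // v; apply: (Ck_ext oU _ (CkM oU (Ck_cst _ _ (v : R^o)) Ch')).
move=> x Ux; have dhx := dh x Ux; rewrite deriveE // diff1E //.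
by rewrite derive1E (@derive_val _ _ _ _ _ _ _ (hh' x Ux)).
Qed.

(** Both functions are treated at once because each is, up to sign, the
    derivative of the other. *)
Lemma smooth_trig : smooth_on setT (@sin R : R^o -> R^o) /\
  smooth_on setT (@cos R : R^o -> R^o).
Proof.
suff H k : Ck_on k setT (@sin R : R^o -> R^o) /\
    Ck_on k setT (@cos R : R^o -> R^o) by split=> k; have [] := H k.
elim: k => [|k [Is Ic]].
  by split=> x _; [exact: continuous_sin|exact: continuous_cos].
split.
  apply: (@CkS_derive1 _ _ _ cos) => //; exact: openT.
apply: (@CkS_derive1 _ _ _ (fun x => - sin x)); first exact: openT.
have := CkM openT (Ck_cst k setT (-1 : R^o)) Is.
by congr Ck_on; apply/funext=> x; rewrite mulN1r.
Qed.

Lemma smooth_inv (U : set R^o) : open U -> ~ U 0 ->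
  smooth_on U (GRing.inv : R^o -> R^o).
Proof.
move=> oU U0; have nz x : U x -> x != 0.
  by move=> Ux; apply/eqP => x0; apply: U0; rewrite -x0.
elim=> [|k IH]; first by move=> x /nz; exact: inv_continuous.
apply: (@CkS_derive1 _ _ _ (fun x => -1 * (x^-1 * x^-1))) => //.
  move=> x /nz x0.
  have := @is_deriveV R id x 1 1 x0 (is_derive_id _ _).
  move/is_derive_eq; apply.
  by rewrite /GRing.scale /= mulr1 mulN1r expr2 invfM.
by apply: CkM => //; [exact: Ck_cst|exact: CkM].
Qed.

Lemma smoothV V (U : set V) (f : V -> R^o) : open U ->
  (forall x, U x -> f x != 0) -> smooth_on U f ->
  smooth_on U (fun x => (f x)^-1 : R^o).
Proof.
move=> oU f0; apply: (@smooth_comp1 _ _ oU [set x : R^o | x != 0]).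
  apply: smooth_inv; last by rewrite /= eqxx.
  exact: open_neq.
by move=> x /f0.
Qed.

Lemma smooth_sqrt_pos :
  smooth_on [set x : R^o | 0 < x] (@Num.sqrt R : R^o -> R^o).
Proof.
have op : open [set x : R^o | 0 < x] by exact: open_gt.
elim=> [|k IH]; first by move=> x _; exact: sqrt_continuous.
apply: (@CkS_derive1 _ _ _ (fun x => (2 * Num.sqrt x)^-1)) => //.
have iC : Ck_on k [set x : R^o | x != 0] (GRing.inv : R^o -> R^o).
  by apply: smooth_inv; [exact: open_neq|rewrite /= eqxx].
apply: (Ck_comp coordinates_scalar op _ _ iC).
  by move=> x /= x0; rewrite mulf_neq0 // gt_eqF // sqrtr_gt0.
by move=> _; apply: (@CkM _ _ _ _ (fun=> 2)) => //; exact: Ck_cst.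
Qed.

Lemma smooth_sqrt V (U : set V) (f : V -> R^o) : open U ->
  (forall x, U x -> 0 < f x) -> smooth_on U f ->
  smooth_on U (fun x => Num.sqrt (f x) : R^o).
Proof. by move=> oU f0; apply: (smooth_comp1 oU smooth_sqrt_pos). Qed.

Lemma smooth_id (U : set R^o) : smooth_on U (fun x : R^o => x : R^o).
Proof. by apply: (@smooth_linear _ _ U idfun) => x; exact: cvg_id. Qed.

Lemma smooth_atan : smooth_on setT (@atan R : R^o -> R^o).
Proof.
case=> [|k]; first by move=> x _; exact: continuous_atan.
apply: (@CkS_derive1 _ _ _ (fun x => (1 + x * x)^-1)); first exact: openT.
apply: (@smoothV _ setT) => //; first exact: openT.
  by move=> x _; rewrite gt_eqF // ltr_pwDl // -expr2 sqr_ge0.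
apply: (@smoothD _ setT openT (fun=> 1)); first exact: smooth_cst.
by apply: (@smoothM _ setT openT); exact: smooth_id.
Qed.
End Smooth.

(** * Smooth maps to and from quotients *)

Section SmoothMaps.
Variable R : realType.
Implicit Types V W : normedModType R.

Lemma open_preimage V W (U : set V) (O : set W) (f : V -> W) : open U ->
  (forall x, U x -> {for x, continuous f}) -> open O -> open (U `&` f @^-1` O).
Proof.
move=> oU cf oO; rewrite openE => x [Ux Ofx]; apply: filterI.
  by apply: open_nbhs_nbhs.
by apply: (cf x Ux); apply: open_nbhs_nbhs.
Qed.

Section Charts.
Variables (V V' : normedModType R) (T T' T'' : Type) (I : finType).
Variables (e : T -> V) (S : set T) (e' : T' -> V') (S' : set T').
Variables (p : T' -> T'') (D : set T'') (U : set V) (U' : set V').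
Hypotheses (oU : open U) (oU' : open U').

(** A map into a quotient is smooth as soon as it lifts, through the
    projection, to the restriction Phi of a smooth map of the ambient spaces:
    by definition of the quotient structure, pulling back a function along F
    amounts to pulling back its lift along Phi. *)
Lemma smooth_map_lift (a : I -> V') (c : I -> V' -> R^o)
    (F : T -> T'') (Ft : T -> T') (Phi : V -> V') :
  coordinates a c -> (forall i, smooth_on U (c i \o Phi)) ->
  (forall x, S x -> [/\ U (e x), S' (Ft x) & e' (Ft x) = Phi (e x)]) ->
  (forall x, S x -> D (F x) /\ p (Ft x) = F x) ->
  smooth_map (embedded e S)
    (open_subspace (quotient_space (embedded e' S') p) D) F.
Proof.
move=> ac sPhi lift fact.
have cPhi x : U x -> {for x, continuous Phi}.
  exact: (Ck_coordinates ac oU (fun i => sPhi i 0%N)).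
split=> [x Sx|W [WD [Wp [Q0 oO WO]]]]; first by have [] := fact x Sx.
have WE x : S x -> W (F x) <-> Q0 (Phi (e x)).
  move=> Sx; have [Ux S'x eE] := lift x Sx; have [_ pE] := fact x Sx.
  have [h1 h2] : (S' `&` p @^-1` W) (Ft x) <-> (S' `&` e' @^-1` Q0) (Ft x).
    by rewrite WO.
  split=> [WFx|Ox].
    by have [] := h1 _; [split=> //=; rewrite pE|rewrite /= eE].
  by have [] := h2 _; [split=> //=; rewrite eE|rewrite /= pE].
split.
  exists (U `&` Phi @^-1` Q0); first exact: open_preimage.
  apply/seteqP; split=> x [Sx].
    by move=> /(WE x Sx) OP; have [Ux _ _] := lift x Sx.
  by move=> [_ OP]; split=> //; apply/WE.
move=> f sf x [Sx WFx]; have [Ux S'x eE] := lift x Sx; have [_ pE] := fact x Sx.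
have [|Q [g [oQ Qx sg fg]]] := sf (Ft x); first by split=> //=; rewrite pE.
exists (U `&` Phi @^-1` Q), (g \o Phi); split.
- exact: open_preimage.
- by split=> //; rewrite /= -eE.
- move=> k; apply: (@Ck_comp _ _ _ _ _ _ _ _ Q _ _ ac _ _ _ (sg k)).
  + exact: open_preimage.
  + by move=> z [].
  + by move=> i; apply: Ck_sub (sPhi i k) => z [].
- move=> z [Sz WFz] [_ Qz].
  have [Uz S'z eEz] := lift z Sz; have [_ pEz] := fact z Sz.
  rewrite /= -eEz -fg /=; first by rewrite pEz.
    by split=> //=; rewrite pEz.
  by rewrite eEz.
Qed.

(** A map out of an open part D of a quotient is smooth as soon as its
    composite with the projection is the restriction of a smooth map Psi of the
    ambient spaces.  U' is the trace of D upstairs. *)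
Lemma smooth_map_descend (a : I -> V) (c : I -> V -> R^o)
    (F : T'' -> T) (Psi : V' -> V) :
  coordinates a c -> (forall i, smooth_on U' (c i \o Psi)) ->
  D `<=` p @` S' -> (forall x, S' x -> D (p x) <-> U' (e' x)) ->
  (forall x, S' x -> D (p x) -> S (F (p x)) /\ e (F (p x)) = Psi (e' x)) ->
  smooth_map (open_subspace (quotient_space (embedded e' S') p) D)
    (embedded e S) F.
Proof.
move=> ac sPsi Dp DU fact.
have cPsi x : U' x -> {for x, continuous Psi}.
  exact: (Ck_coordinates ac oU' (fun i => sPsi i 0%N)).
split=> [y Dy|W [Q0 oO WO]].
  have [x S'x pxy] := Dp y Dy; rewrite -pxy in Dy *.
  by have [] := fact x S'x Dy.
split.
  split; first by move=> y [].
  split; first by move=> y [/Dp].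
  exists (U' `&` Psi @^-1` Q0); first exact: open_preimage.
  apply/seteqP; split=> x [S'x].
    move=> [Dx WFx]; have [Sx eE] := fact x S'x Dx.
    split=> //; split; first exact/DU.
    by move: WFx; rewrite /= WO => -[_]; rewrite /= eE.
  move=> [U'x Ox]; have Dx : D (p x) by apply/DU.
  have [Sx eE] := fact x S'x Dx; split=> //; split=> //=.
  by rewrite WO; split=> //=; rewrite eE.
move=> f sf x [S'x [Dx WFx]]; have [Sx eE] := fact x S'x Dx.
have [Q [g [oQ Qx sg fg]]] := sf _ WFx.
exists (U' `&` Psi @^-1` Q), (g \o Psi); split.
- exact: open_preimage.
- by split; [exact/DU|rewrite /= -eE].
- move=> k; apply: (@Ck_comp _ _ _ _ _ _ _ _ Q _ _ ac _ _ _ (sg k)).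
  + exact: open_preimage.
  + by move=> z [].
  + by move=> i; apply: Ck_sub (sPsi i k) => z [].
- move=> z [S'z [Dz WFz]] [_ Qz]; have [Sz eEz] := fact z S'z Dz.
  by rewrite /= -eEz -fg //= eEz.
Qed.
End Charts.

Lemma smooth_mx2 V (U : set V) (a b c d : V -> R^o) i j :
  smooth_on U a -> smooth_on U b -> smooth_on U c -> smooth_on U d ->
  smooth_on U (fun x => mx2 (a x) (b x) (c x) (d x) i j : R^o).
Proof.
move=> sa sb sc sd.
rewrite (_ : (fun _ => _) = if i == ord0 then (if j == ord0 then a else b)
                            else (if j == ord0 then c else d)).
  by case: ifP => _; case: ifP.
by apply/funext => x; rewrite mxE; case: ifP => _; case: ifP.
Qed.

Lemma smooth_entry V m n (U : set V)
    (f : {linear V -> 'M[R]_(m.+1, n.+1)}) i j :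
  continuous f -> smooth_on U (fun x => f x i j : R^o).
Proof.
move=> cf.
have lin : linear (fun x => f x i j : R^o).
  by move=> k x y; rewrite linearP !mxE.
pose linM := GRing.isLinear.Build _ _ _ _ _ lin.
pose l : {linear V -> R^o} := HB.pack (fun x => f x i j : R^o) linM.
apply: (@smooth_linear _ _ _ U l) => x.
apply: (@continuous_comp _ _ _ f (fun M => M i j)); first exact: cf.
exact: coord_continuous.
Qed.

End SmoothMaps.

(** * The symmetric invariant of a coset *)

Section TwoByTwo.

Lemma mx2_eq (T : Type) (a b c d a' b' c' d' : T) :
  a = a' -> b = b' -> c = c' -> d = d' -> mx2 a b c d = mx2 a' b' c' d'.
Proof. by move=> -> -> -> ->. Qed.

Lemma mx2_eta (T : Type) (A : 'M[T]_2) :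
  A = mx2 (A ord0 ord0) (A ord0 ord_max) (A ord_max ord0) (A ord_max ord_max).
Proof.
apply/matrixP => i j; rewrite mxE.
by case: ifPn => /eqP hi; case: ifPn => /eqP hj; congr (A _ _); apply/val_inj;
  case: i hi => -[|[|//]] // ? hi; case: j hj => -[|[|//]] // ? hj;
  try (by case: hi; apply/val_inj); by case: hj; apply/val_inj.
Qed.

Lemma map_mx2 (T T' : Type) (f : T -> T') (a b c d : T) :
  map_mx f (mx2 a b c d) = mx2 (f a) (f b) (f c) (f d).
Proof. by apply/matrixP => i j; rewrite !mxE; case: ifP => _; case: ifP. Qed.

Lemma tr_mx2 (T : Type) (a b c d : T) : (mx2 a b c d)^T = mx2 a c b d.
Proof. by apply/matrixP => i j; rewrite !mxE; case: ifP => _; case: ifP. Qed.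

Variable T : comNzRingType.
Implicit Types a b c d : T.

Lemma mul_mx2 a b c d a' b' c' d' :
  mx2 a b c d *m mx2 a' b' c' d' =
  mx2 (a * a' + b * c') (a * b' + b * d') (c * a' + d * c') (c * b' + d * d').
Proof.
apply/matrixP => i j; rewrite !mxE !big_ord_recl big_ord0 !mxE /= addr0.
by case: ifP => _; case: ifP.
Qed.

Lemma scale_mx2 k a b c d :
  k *: mx2 a b c d = mx2 (k * a) (k * b) (k * c) (k * d).
Proof. by apply/matrixP => i j; rewrite !mxE; case: ifP => _; case: ifP. Qed.

Lemma det_mx2 a b c d : \det (mx2 a b c d) = a * d - b * c.
Proof.
rewrite (expand_det_row _ ord0) !big_ord_recl big_ord0 /cofactor !det_mx11.
rewrite !mxE /=.
by rewrite /bump /=; ring.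
Qed.

Lemma one_mx2 : 1%:M = mx2 (1 : T) 0 0 1.
Proof.
by rewrite (mx2_eta 1%:M); apply: mx2_eq; rewrite !mxE.
Qed.

(** The invariant g g^T: the map g |-> g g^T is constant exactly on the left
    cosets of the orthogonal group. *)
Definition gram (g : 'M[T]_2) := g *m g^T.

Lemma gram_mx2 a b c d : gram (mx2 a b c d) =
  mx2 (a ^+ 2 + b ^+ 2) (a * c + b * d) (a * c + b * d) (c ^+ 2 + d ^+ 2).
Proof. by rewrite /gram tr_mx2 mul_mx2; apply: mx2_eq; ring. Qed.
End TwoByTwo.

(** The missing entry is recovered from det (g g^T) = 1. *)
Lemma gram_eq (F : fieldType) (g h : 'M[F]_2) : \det g = 1 -> \det h = 1 ->
  gram g ord_max ord_max != 0 ->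
  gram g ord_max ord_max = gram h ord_max ord_max ->
  gram g ord0 ord_max = gram h ord0 ord_max -> gram g = gram h.
Proof.
rewrite (mx2_eta g) (mx2_eta h) !gram_mx2 !det_mx2 !mxE /=.
set a := g ord0 ord0; set b := g ord0 ord_max.
set c := g ord_max ord0; set d := g ord_max ord_max.
set a' := h ord0 ord0; set b' := h ord0 ord_max.
set c' := h ord_max ord0; set d' := h ord_max ord_max => dg dh r0 er eq_.
apply: mx2_eq => //.
apply: (mulIf r0).
(* Lagrange's identity: det (g g^T) = (det g)^2 *)
transitivity ((a * d - b * c) ^+ 2 + (a * c + b * d) ^+ 2); first by ring.
by rewrite er dg eq_ -dh; ring.
Qed.

Section Cosets.
Variable R : realType.
Implicit Types g h k : 'M[R[i]]_2.

Lemma mem_coset g h : SL2C g ->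
  (h \in actC g (@x0 R)) <-> (SL2C h /\ gram h = gram g).
Proof.
rewrite /SL2C /= => dg; rewrite inE; split.
  move=> [k [/mulmx1C kk dk] <-]; split.
    by rewrite /= det_mulmx dg dk mulr1.
  by rewrite /gram trmx_mul mulmxA -(mulmxA g) kk mulmx1.
have ug : g \in unitmx by rewrite unitmxE dg unitr1.
move=> [dh hg]; exists (invmx g *m h); last by rewrite mulmxA mulmxV ?mul1mx.
split; last by rewrite det_mulmx det_inv dg dh invr1 mulr1.
apply: mulmx1C; rewrite trmx_mul mulmxA -(mulmxA (invmx g)) -/(gram h) hg /gram.
by rewrite mulmxA mulVmx // mul1mx -trmx_mul mulVmx // trmx1.
Qed.

(** If g g^T = h h^T, then k = g^-1 h satisfies k k^T = 1. *)
Lemma eq_coset g h : SL2C g -> SL2C h ->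
  actC g (@x0 R) = actC h (@x0 R) <-> gram g = gram h.
Proof.
move=> sg sh; split=> [gh|gh].
  have : g \in actC g (@x0 R) by apply/mem_coset.
  by rewrite gh => /(mem_coset _ sh)[].
apply/seteqP; split=> z /mem_set.
  move=> /(mem_coset _ sg)[sz zg].
  by apply/set_mem/(mem_coset _ sh); rewrite -gh.
move=> /(mem_coset _ sh)[sz zg].
by apply/set_mem/(mem_coset _ sg); rewrite gh.
Qed.

Lemma actC_mul g h x : actC (g *m h) x = actC g (actC h x).
Proof.
apply/seteqP; split=> z.
  by move=> [k xk <-]; exists (h *m k); [exists k|rewrite mulmxA].
by move=> [_ [k xk <-] <-]; exists k => //; rewrite mulmxA.
Qed.
End Cosets.

Lemma complex_ext (R : realType) (z w : R[i]) :
  complex.Re z = complex.Re w -> complex.Im z = complex.Im w -> z = w.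
Proof. by case: z w => [a b] [c d] /= -> ->. Qed.

(** * Exponentials of the Lie algebra elements *)

Section Exponentials.
Variable R : realType.

Lemma mexp_partial_diag (z w : R[i]) n :
  mexp_partial (mx2 z 0 0 w) n =
  mx2 (\sum_(k < n) (k`!%:R)^-1 * z ^+ k) 0
      0 (\sum_(k < n) (k`!%:R)^-1 * w ^+ k).
Proof.
have powE k : mx2 z 0 0 w ^+ k = mx2 (z ^+ k) 0 0 (w ^+ k).
  elim: k => [|k IH]; first by rewrite !expr0 -one_mx2.
  by rewrite exprS IH -[LHS]/(_ *m _) mul_mx2 !exprS; apply: mx2_eq; ring.
rewrite /mexp_partial; elim: n => [|n IH].
  rewrite !big_ord0; apply/matrixP => i j; rewrite !mxE.
  by case: ifP; case: ifP.
rewrite !big_ord_recr /= IH powE scale_mx2.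
apply/matrixP => i j; rewrite !mxE.
by case: ifP => _; case: ifP => _; rewrite ?mulr0 ?addr0.
Qed.

(** Euler's formula, one term of the power series at a time. *)
Lemma exp_i_coeff (x : R) n : (n`!%:R)^-1 * (0 +i* x) ^+ n =
  cos_coeff x n +i* sin_coeff x n.
Proof.
have powE : (0 +i* x) ^+ n =
    ((~~ odd n)%:R * (-1) ^+ n./2 * x ^+ n) +i*
    ((odd n)%:R * (-1) ^+ n.-1./2 * x ^+ n).
  elim: n => [|n IH].
    by apply/complex_ext; rewrite !expr0 /= ?mul1r ?mul0r.
  rewrite exprS IH; case: n {IH} => [|n].
    by apply/complex_ext; rewrite /= !expr0 !expr1; ring.
  by apply/complex_ext; rewrite /= ?uphalf_half negbK; case: (odd n) => /=;
    rewrite ?add1n ?add0n ?exprS; ring.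
have -> : (n`!%:R)^-1 = ((n`!%:R)^-1)%:C :> R[i] by rewrite fmorphV rmorph_nat.
rewrite powE; apply/complex_ext; rewrite /cos_coeff /sin_coeff /=.
  by rewrite -exprnP; ring.
by ring.
Qed.

Lemma sum_exp_i_coeff (x : R) n :
  \sum_(k < n) (k`!%:R)^-1 * (0 +i* x) ^+ k =
  series (cos_coeff x) n +i* series (sin_coeff x) n.
Proof.
rewrite /series /= !big_mkord; elim: n => [|n IH]; first by rewrite !big_ord0.
by rewrite !big_ord_recr /= IH exp_i_coeff.
Qed.

Lemma expi_diag (x : R) : expi (mx2 x 0 0 (- x)) =
  mx2 (cos x +i* sin x) 0 0 (cos x -i* sin x).
Proof.
rewrite /expi.
have -> : ((0 +i* 1) *: cplx (mx2 x 0 0 (- x))) =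
    mx2 (0 +i* x) 0 0 (0 +i* (- x)).
  rewrite /cplx map_mx2 scale_mx2.
  by apply: mx2_eq; apply/complex_ext => /=; ring.
have lim0 : limn (fun=> 0 : R) = 0 by exact: lim_cst.
rewrite /mexp; apply/matrixP => i j; rewrite !mxE.
under eq_fun do rewrite mexp_partial_diag !sum_exp_i_coeff !mxE.
under [X in _ +i* limn X]eq_fun do
  rewrite mexp_partial_diag !sum_exp_i_coeff !mxE.
case: ifP => _; case: ifP => _ //=; rewrite ?lim0 //.
  by rewrite !unlock.
by rewrite -sinN -[in RHS]cosN !unlock.
Qed.

Lemma expi_nilpotent (y : R) : expi (mx2 0 y 0 0) = mx2 1 (0 +i* y) 0 1.
Proof.
rewrite /expi.
have -> : ((0 +i* 1) *: cplx (mx2 0 y 0 0)) = mx2 0 (0 +i* y) 0 0.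
  rewrite /cplx map_mx2 scale_mx2.
  by apply: mx2_eq; apply/complex_ext => /=; ring.
have partialE n : mexp_partial (mx2 0 (0 +i* y) 0 0) n.+2 = mx2 1 (0 +i* y) 0 1.
  rewrite /mexp_partial; elim: n => [|n IH]; rewrite big_ord_recr /=.
    rewrite big_ord_recr big_ord0 /= expr0 expr1 add0r !fact0 invr1 !scale1r.
    rewrite -[1]/(1%:M) one_mx2; apply/matrixP => i j; rewrite !mxE.
    by case: ifP => _; case: ifP => _; rewrite ?addr0 ?add0r.
  have Z2 : mx2 0 (0 +i* y) 0 0 * mx2 0 (0 +i* y) 0 0 = 0 :> 'M[R[i]]_2.
    rewrite -[_ * _]/(_ *m _) mul_mx2 !mul0r !mulr0 !addr0.
    by apply/matrixP => i j; rewrite !mxE; case: ifP => _; case: ifP.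
  by rewrite IH exprS exprS mulrA Z2 mul0r scaler0 addr0.
have limE (f : 'M[R[i]]_2 -> R) :
    limn (fun n => f (mexp_partial (mx2 0 (0 +i* y) 0 0) n)) =
    f (mx2 1 (0 +i* y) 0 1).
  apply/cvg_lim => //; apply: (@cvg_near_cst _ _ _ _ _ _).
  (* the square of the matrix vanishes: partial sums are constant from 2 on *)
  by exists 2%N => // -[|[|n]] //= _; rewrite partialE.
rewrite /mexp; apply/matrixP => i j; rewrite mxE.
rewrite (limE (fun Z => complex.Re (Z i j))).
rewrite (limE (fun Z => complex.Im (Z i j))).
by apply: complex_ext.
Qed.
End Exponentials.

(** * Real trigonometry and a rotation *)

Section Real.
Variable R : realType.
Implicit Types u v c s t x y th : R.

(** v / u is the tangent of the argument of u + i v when u > 0. *)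
Lemma cos_sin_atan u v : 0 < u ->
  cos (atan (v / u)) = u / Num.sqrt (u ^+ 2 + v ^+ 2) /\
  sin (atan (v / u)) = v / Num.sqrt (u ^+ 2 + v ^+ 2).
Proof.
move=> u0; have un0 : u != 0 by rewrite gt_eqF.
have rho0 : 0 < u ^+ 2 + v ^+ 2 by rewrite ltr_pwDl ?exprn_gt0 ?sqr_ge0.
have cE : cos (atan (v / u)) = u / Num.sqrt (u ^+ 2 + v ^+ 2).
  rewrite cos_atan.
  have -> : 1 + (v / u) ^+ 2 = (u ^+ 2 + v ^+ 2) / u ^+ 2 by field.
  rewrite sqrtrM ?(ltW rho0) // sqrtrV ?sqr_ge0 // sqrtr_sqr gtr0_norm //.
  by rewrite invfM invrK mulrC.
split=> //.
have cn0 : cos (atan (v / u)) != 0.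
  by rewrite cE mulf_neq0 ?invr_neq0 // gt_eqF // sqrtr_gt0.
have : tan (atan (v / u)) = v / u by rewrite atanK.
move/(canRL (divfK cn0)) => ->; rewrite cE; field.
by rewrite un0 gt_eqF // sqrtr_gt0.
Qed.

Lemma atan_sin_cos rho th : 0 < rho -> - (pi / 2) < th < pi / 2 ->
  atan (rho * sin th / (rho * cos th)) = th.
Proof.
move=> r0 hth; rewrite -mulf_div divff ?gt_eqF // mul1r; apply: tanK.
by rewrite in_itv.
Qed.

Lemma cos_sin_double th :
  cos (2 * th) = cos th ^+ 2 - sin th ^+ 2 /\
  sin (2 * th) = 2 * (cos th * sin th).
Proof.
by rewrite mulr_natl mulr2n cosD sinD; split; ring.
Qed.

(** The matrix ((a, y), (y, - a)) has eigenvalues L and - L with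
    L^2 = a^2 + y^2, and (p, q) is a unit eigenvector for L.  The angle th is
    half the argument of c + i L, a number of modulus one by assumption. *)
Lemma diagonalize_symmetric c a y : 0 < c -> c ^+ 2 + a ^+ 2 + y ^+ 2 = 1 ->
  exists p q th, [/\ p ^+ 2 + q ^+ 2 = 1, - (pi / 4) < th < pi / 4,
    cos (2 * th) = c, sin (2 * th) * (p ^+ 2 - q ^+ 2) = a &
    sin (2 * th) * (2 * (p * q)) = y].
Proof.
move=> c0 cay; pose L := Num.sqrt (a ^+ 2 + y ^+ 2).
have s0 : 0 <= a ^+ 2 + y ^+ 2 by rewrite addr_ge0 ?sqr_ge0.
have L2 : L ^+ 2 = a ^+ 2 + y ^+ 2 by rewrite sqr_sqrtr.
have L0 : 0 <= L by exact: sqrtr_ge0.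
have [cE sE] := @cos_sin_atan c L c0.
have rho1 : Num.sqrt (c ^+ 2 + L ^+ 2) = 1 by rewrite L2 addrA cay sqrtr1.
rewrite rho1 !divr1 in cE sE.
have [p [q [pq1 pqa pqy]]] : exists p q, [/\ p ^+ 2 + q ^+ 2 = 1,
    L * (p ^+ 2 - q ^+ 2) = a & L * (2 * (p * q)) = y].
  have aL : `|a| <= L by rewrite -sqrtr_sqr ler_wsqrtr // lerDl sqr_ge0.
  have La : 0 <= L + a by move: aL; rewrite ler_norml => /andP[? _]; lra.
  (* (L + a, y) is an eigenvector unless it vanishes, when y = 0 and a = - L *)
  move: La; rewrite le_eqVlt => /predU1P[La|La].
    have aE : a = - L by lra.
    have y0 : y = 0.
      by apply/eqP; rewrite -sqrf_eq0; apply/eqP; move: L2; rewrite aE; lra.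
    by exists 0, 1; split; rewrite ?y0 ?aE; ring.
  have Lp : 0 < L.
    rewrite lt0r L0 andbT; apply/eqP => L00; move: aL La.
    by rewrite L00 normr_le0 => /eqP ->; rewrite addr0 ltxx.
  pose n := Num.sqrt (2 * L * (L + a)).
  have n2 : n ^+ 2 = 2 * L * (L + a) by rewrite sqr_sqrtr // !mulr_ge0 // ltW.
  have nn0 : n != 0 by rewrite gt_eqF // sqrtr_gt0 !mulr_gt0.
  have y2 : y ^+ 2 = (L - a) * (L + a).
    by rewrite -[y ^+ 2](addKr (a ^+ 2)) -L2; ring.
  have [Ln0 Lan0] : L != 0 /\ L + a != 0 by rewrite !gt_eqF.
  exists ((L + a) / n), (y / n); split.
  - by rewrite !expr_div_n n2 y2; field; rewrite Ln0 Lan0.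
  - by rewrite !expr_div_n n2 y2; field; rewrite Ln0 Lan0.
  - transitivity (L * 2 * ((L + a) * y) / n ^+ 2); first by field.
    by rewrite n2; field; rewrite Ln0 Lan0.
exists p, q, (atan (L / c) / 2).
have -> : 2 * (atan (L / c) / 2) = atan (L / c) by field.
rewrite cE sE; split => //.
have := atan_gtNpi2 (L / c); have := atan_ltpi2 (L / c).
by move=> ? ?; apply/andP; split; lra.
Qed.
End Real.

(** * Horospherical coordinates and the crown *)

Section Horospherical.
Variable R : realType.
Implicit Types t x y th : R.

Definition crown_param t x th y : 'M[R]_2 * 'M[R]_2 * 'M[R]_2 :=
  (mx2 t (x / t) 0 t^-1, mx2 th 0 0 (- th), mx2 0 y 0 0).

(** The product b exp(iH) exp(iY), written out entrywise. *)
Definition crown_lift t x th y : 'M[R[i]]_2 :=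
  let c := cos th in let s := sin th in
  mx2 ((t * c) +i* (t * s))
      ((x / t * c - t * y * s) +i* (t * y * c - x / t * s))
      0 ((c / t) -i* (s / t)).

Lemma subgroupNA_P (b : 'M[R]_2) : subgroupNA b <->
  exists t x, 0 < t /\ b = mx2 t (x / t) 0 t^-1.
Proof.
split=> [[_ [x _ <-] [_ [t t0 <-] <-]]|[t [x [t0 ->]]]].
  by exists t, x; split=> //; rewrite mul_mx2; apply: mx2_eq; ring.
exists (mx2 1 x 0 1); first by exists x.
exists (mx2 t 0 0 t^-1); first by exists t.
by rewrite mul_mx2; apply: mx2_eq; ring.
Qed.

Lemma parametersP (p : 'M[R]_2 * 'M[R]_2 * 'M[R]_2) : parameters p <->
  exists t x th y, [/\ 0 < t, - (pi / 4) < th < pi / 4, -1 < y < 1 &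
    p = crown_param t x th y].
Proof.
split.
  case: p => [[b H] Y] [[/= /subgroupNA_P[t [x [t0 ->]]] [th hth <-]]].
  by move=> [y hy <-]; exists t, x, th, y.
move=> [t [x [th [y [t0 hth hy ->]]]]]; split; last by exists y.
by split; [apply/subgroupNA_P; exists t, x|exists th].
Qed.

Lemma crown_liftE t x th y :
  cplx (crown_param t x th y).1.1 *m expi (crown_param t x th y).1.2 *m
    expi (crown_param t x th y).2 = crown_lift t x th y.
Proof.
rewrite /= expi_diag expi_nilpotent /cplx map_mx2 !mul_mx2 /crown_lift.
by apply: mx2_eq; apply/complex_ext => /=; ring.
Qed.

Lemma crown_mapE t x th y :
  crown_map (crown_param t x th y) = actC (crown_lift t x th y) (@x0 R).
Proof. by rewrite /crown_map crown_liftE. Qed.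

Lemma det_crown_lift t x th y : t != 0 -> SL2C (crown_lift t x th y).
Proof.
move=> t0; rewrite /SL2C /= det_mx2 mulr0 subr0; apply/complex_ext => /=.
  by rewrite -[RHS](cos2Dsin2 th); field.
by field.
Qed.

(** r1 + i r2 and q1 + i q2 are the entries (1,1) and (0,1) of g g^T, as real
    polynomials in the real and imaginary parts of the entries of g. *)
Definition r1 (p : 'M[R]_2 * 'M[R]_2) : R :=
  p.1 ord_max ord0 * p.1 ord_max ord0 +
  p.1 ord_max ord_max * p.1 ord_max ord_max -
  (p.2 ord_max ord0 * p.2 ord_max ord0 +
   p.2 ord_max ord_max * p.2 ord_max ord_max).
Definition r2 (p : 'M[R]_2 * 'M[R]_2) : R :=
  2 * (p.1 ord_max ord0 * p.2 ord_max ord0 +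
       p.1 ord_max ord_max * p.2 ord_max ord_max).
Definition q1 (p : 'M[R]_2 * 'M[R]_2) : R :=
  p.1 ord0 ord0 * p.1 ord_max ord0 + p.1 ord0 ord_max * p.1 ord_max ord_max -
  (p.2 ord0 ord0 * p.2 ord_max ord0 + p.2 ord0 ord_max * p.2 ord_max ord_max).
Definition q2 (p : 'M[R]_2 * 'M[R]_2) : R :=
  p.1 ord0 ord0 * p.2 ord_max ord0 + p.1 ord0 ord_max * p.2 ord_max ord_max +
  (p.2 ord0 ord0 * p.1 ord_max ord0 + p.2 ord0 ord_max * p.1 ord_max ord_max).

Lemma gram_realify (g : 'M[R[i]]_2) :
  gram g ord_max ord_max = r1 (realify g) +i* r2 (realify g) /\
  gram g ord0 ord_max = q1 (realify g) +i* q2 (realify g).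
Proof.
rewrite [in gram g](mx2_eta g) gram_mx2 /r1 /r2 /q1 /q2 /= !mxE /=.
case: (g ord0 ord0) => a1 a2; case: (g ord0 ord_max) => b1 b2.
case: (g ord_max ord0) => c1 c2; case: (g ord_max ord_max) => d1 d2.
by split; apply/complex_ext => /=; ring.
Qed.

Lemma gram_crown_lift t x th y : t != 0 ->
  gram (crown_lift t x th y) ord_max ord_max =
    (cos (2 * th) / t ^+ 2) -i* (sin (2 * th) / t ^+ 2) /\
  gram (crown_lift t x th y) ord0 ord_max =
    (x * (cos (2 * th) / t ^+ 2)) +i* (y - x * (sin (2 * th) / t ^+ 2)).
Proof.
move=> t0; have [-> ->] := cos_sin_double th.
rewrite /crown_lift gram_mx2 !mxE /=.
split; apply/complex_ext => /=; try by field.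
transitivity
  (y * (cos th ^+ 2 + sin th ^+ 2) - x * (2 * (cos th * sin th) / t ^+ 2)).
  by field.
by rewrite cos2Dsin2 mulr1.
Qed.

(** The coordinate y, from q = i y + x r with x real. *)
Definition shear (p : 'M[R]_2 * 'M[R]_2) : R :=
  q2 p - q1 p * (r2 p / r1 p).

(** The inverse of crown_map, from r = exp(- 2 i th) / t^2 and
    q = i y + x r: the modulus of r gives t, its argument gives th. *)
Definition horo_coord (p : 'M[R]_2 * 'M[R]_2) :=
  crown_param (Num.sqrt (Num.sqrt (r1 p * r1 p + r2 p * r2 p)))^-1 (q1 p / r1 p)
    (- (2^-1 * atan (r2 p / r1 p))) (shear p).

Lemma pi4_double th :
  (- (pi / 4) < th < pi / 4) = (- (pi / 2) < 2 * th < pi / 2).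
Proof. by apply/andP/andP => -[? ?]; split; lra. Qed.

Lemma horo_coord_gram (g : 'M[R[i]]_2) t x th y :
  0 < t -> - (pi / 4) < th < pi / 4 ->
  gram g = gram (crown_lift t x th y) ->
  [/\ horo_coord (realify g) = crown_param t x th y, 0 < r1 (realify g) &
      shear (realify g) = y].
Proof.
move=> t0 hth gE; have tn0 : t != 0 by rewrite gt_eqF.
have [er eq_] := gram_crown_lift x th y tn0.
have [er' eq'] := gram_realify g.
move: er' eq'; rewrite gE er eq_ => -[er1 er2] [eq1 eq2].
rewrite pi4_double in hth.
have c0 : 0 < cos (2 * th) by exact: cos_gt0_pihalf.
have r10 : 0 < r1 (realify g) by rewrite -er1 divr_gt0 // exprn_gt0.
have hE : shear (realify g) = y.
  by rewrite /shear -eq1 -eq2 -er1 -er2; field; rewrite tn0 gt_eqF.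
split=> //; rewrite /horo_coord hE; congr crown_param.
- rewrite -er1 -er2.
  have -> : cos (2 * th) / t ^+ 2 * (cos (2 * th) / t ^+ 2) +
      - (sin (2 * th) / t ^+ 2) * - (sin (2 * th) / t ^+ 2) = (t^-1 ^+ 2) ^+ 2.
    transitivity ((t^-1 ^+ 2) ^+ 2 * (cos (2 * th) ^+ 2 + sin (2 * th) ^+ 2)).
      by field.
    by rewrite cos2Dsin2 mulr1.
  rewrite [Num.sqrt (_ ^+ 2)]sqrtr_sqr ger0_norm ?sqr_ge0 // sqrtr_sqr.
  by rewrite gtr0_norm ?invr_gt0 // invrK.
- by rewrite -eq1 -er1; field; rewrite tn0 gt_eqF.
- rewrite -er1 -er2.
  have -> : - (sin (2 * th) / t ^+ 2) = (t ^- 2) * sin (- (2 * th)).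
    by rewrite sinN; ring.
  have -> : cos (2 * th) / t ^+ 2 = (t ^- 2) * cos (- (2 * th)).
    by rewrite cosN; ring.
  rewrite atan_sin_cos; first by field.
    by rewrite invr_gt0 exprn_gt0.
  by case/andP: hth => ? ?; apply/andP; split; lra.
Qed.

Lemma gram_horo_coord (g : 'M[R[i]]_2) :
  SL2C g -> 0 < r1 (realify g) -> `|shear (realify g)| < 1 ->
  exists t x th y, [/\ 0 < t, - (pi / 4) < th < pi / 4, -1 < y < 1 &
    gram g = gram (crown_lift t x th y)].
Proof.
move=> sg r10 hy; set p := realify g in r10 hy.
have rho0 : 0 < r1 p ^+ 2 + r2 p ^+ 2 by rewrite ltr_pwDl ?exprn_gt0 ?sqr_ge0.
pose rho := Num.sqrt (r1 p ^+ 2 + r2 p ^+ 2).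
have rhop : 0 < rho by rewrite sqrtr_gt0.
pose t := (Num.sqrt rho)^-1.
have t0 : 0 < t by rewrite invr_gt0 sqrtr_gt0.
have t2 : t ^+ 2 = rho^-1 by rewrite /t exprVn sqr_sqrtr // ltW.
exists t, (q1 p / r1 p), (- (2^-1 * atan (r2 p / r1 p))), (shear p).
split=> //; last first.
- have tn0 : t != 0 by rewrite gt_eqF.
  have [er eq_] := gram_realify g; rewrite -/p in er eq_.
  have [er' eq'] := gram_crown_lift (q1 p / r1 p)
    (- (2^-1 * atan (r2 p / r1 p))) (shear p) tn0.
  have dbl : 2 * - (2^-1 * atan (r2 p / r1 p)) = - atan (r2 p / r1 p) by field.
  rewrite dbl t2 invrK cosN sinN in er' eq'.
  have [cE sE] := @cos_sin_atan R (r1 p) (r2 p) r10.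
  rewrite cE sE -/rho mulNr !divfK ?gt_eqF // in er' eq'.
  apply: gram_eq => //; first exact: det_crown_lift.
  + by rewrite er eq_complex /= negb_and gt_eqF.
  + by rewrite er er' opprK.
  + by rewrite eq_ eq' /shear; apply/complex_ext => /=; field; rewrite ?gt_eqF.
- by rewrite -ltr_norml.
- have := atan_gtNpi2 (r2 p / r1 p); have := atan_ltpi2 (r2 p / r1 p).
  by move=> ? ?; apply/andP; split; lra.
Qed.

Lemma gram_real_diag (a b c d ph : R) :
  gram (cplx (mx2 a b c d) *m expi (mx2 ph 0 0 (- ph))) ord_max ord_max =
    (cos (2 * ph) * (c ^+ 2 + d ^+ 2)) +i* (sin (2 * ph) * (c ^+ 2 - d ^+ 2)) /\
  gram (cplx (mx2 a b c d) *m expi (mx2 ph 0 0 (- ph))) ord0 ord_max =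
    (cos (2 * ph) * (a * c + b * d)) +i* (sin (2 * ph) * (a * c - b * d)).
Proof.
have [-> ->] := cos_sin_double ph.
rewrite /cplx map_mx2 expi_diag mul_mx2 gram_mx2 !mxE /=.
by split; apply/complex_ext => /=; ring.
Qed.

Lemma SL2C_real_diag (g : 'M[R]_2) (ph : R) : SL2R g ->
  SL2C (cplx g *m expi (mx2 ph 0 0 (- ph))).
Proof.
move=> sg; rewrite /SL2C /= det_mulmx /cplx det_map_mx sg rmorph1 mul1r.
rewrite expi_diag det_mx2; apply/complex_ext => /=; last by ring.
by rewrite -[RHS](cos2Dsin2 ph); ring.
Qed.

(** By the change of basis diag(n, 1/n) with n^4 = 1 - y^2 the real part of
    the invariant of exp(iH) exp(iY) becomes the scalar n^2 cos(2 th), and the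
    imaginary part the symmetric matrix with rows (n^2 sin(2 th), y) and
    (y, - n^2 sin(2 th)), which a rotation diagonalizes.  So the point is
    g exp(iH') x_0 with g the product of b, the change of basis and the
    rotation. *)
Lemma crown_map_in_crown (w : 'M[R]_2 * 'M[R]_2 * 'M[R]_2) :
  parameters w -> crown (crown_map w).
Proof.
move=> /parametersP[t [x [th [y [t0 hth hy ->]]]]]; rewrite crown_mapE.
have tn0 : t != 0 by rewrite gt_eqF.
have y1 : 0 < 1 - y ^+ 2.
  have -> : 1 - y ^+ 2 = (1 - y) * (1 + y) by ring.
  by have /andP[? ?] := hy; rewrite mulr_gt0; lra.
pose m := Num.sqrt (1 - y ^+ 2).
have m0 : 0 < m by rewrite sqrtr_gt0.
have m2 : m ^+ 2 = 1 - y ^+ 2 by rewrite sqr_sqrtr // ltW.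
have c0 : 0 < cos (2 * th) by rewrite cos_gt0_pihalf // -pi4_double.
have [p [q [ph [pq1 hph cE aE yE]]]] : exists p q ph, [/\ p ^+ 2 + q ^+ 2 = 1,
    - (pi / 4) < ph < pi / 4, cos (2 * ph) = m * cos (2 * th),
    sin (2 * ph) * (p ^+ 2 - q ^+ 2) = m * sin (2 * th) &
    sin (2 * ph) * (2 * (p * q)) = y].
  apply: diagonalize_symmetric; first exact: mulr_gt0.
  by rewrite !exprMn -mulrDr cos2Dsin2 m2; ring.
pose n := Num.sqrt m.
have n0 : 0 < n by rewrite sqrtr_gt0.
have n2 : n ^+ 2 = m by rewrite sqr_sqrtr // ltW.
pose g := mx2 t (x / t) 0 t^-1 *m (mx2 n 0 0 n^-1 *m mx2 p (- q) q p).
have nn0 : n != 0 by rewrite gt_eqF.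
have sg : SL2R g.
  by rewrite /SL2R /= /g !mul_mx2 det_mx2 -[RHS]pq1; field; rewrite ?tn0 ?nn0.
exists g => //; exists (mx2 ph 0 0 (- ph)); first by exists ph.
have sc := SL2C_real_diag ph sg.
apply/eq_coset => //; first exact: det_crown_lift.
have [er eq_] := gram_crown_lift x th y tn0.
have cn0 : cos (2 * th) != 0 by rewrite gt_eqF.
apply/esym; apply: gram_eq; [exact: det_crown_lift|exact: sc| | | ].
- rewrite er eq_complex /= negb_and; apply/orP; left.
  by apply: mulf_neq0 => //; rewrite invr_eq0 sqrf_eq0.
- rewrite er /g !mul_mx2 (gram_real_diag _ _ _ _ ph).1.
  apply/complex_ext => /=.
    transitivity (cos (2 * ph) * (p ^+ 2 + q ^+ 2) / (n ^+ 2 * t ^+ 2)).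
      by rewrite pq1 cE n2; field; rewrite ?tn0 ?gt_eqF.
    by field; rewrite ?tn0 ?nn0.
  transitivity (- (sin (2 * ph) * (p ^+ 2 - q ^+ 2)) / (n ^+ 2 * t ^+ 2)).
    by rewrite aE n2; field; rewrite ?tn0 ?gt_eqF.
  by field; rewrite ?tn0 ?nn0.
- rewrite eq_ /g !mul_mx2 (gram_real_diag _ _ _ _ ph).2.
  apply/complex_ext => /=.
    transitivity (cos (2 * ph) * (p ^+ 2 + q ^+ 2) * x / (n ^+ 2 * t ^+ 2)).
      by rewrite pq1 cE n2; field; rewrite ?tn0 ?gt_eqF.
    by field; rewrite ?tn0 ?nn0.
  transitivity (sin (2 * ph) * (2 * (p * q)) -
      x * (sin (2 * ph) * (p ^+ 2 - q ^+ 2)) / (n ^+ 2 * t ^+ 2)).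
    by rewrite aE yE n2; field; rewrite ?tn0 ?gt_eqF.
  by field; rewrite ?tn0 ?nn0.
Qed.

(** For g = ((a, b), (c, d)) real of determinant one,
    y = 2 c d sin(2 th) / (c^2 + d^2), and |2 c d| <= c^2 + d^2. *)
Lemma crown_gram (g : 'M[R[i]]_2) : SL2C g -> crown (actC g (@x0 R)) ->
  0 < r1 (realify g) /\ `|shear (realify g)| < 1.
Proof.
move=> sg [h sh [_ [ph hph <-] /eq_coset]].
move=> /(_ (SL2C_real_diag ph sh) sg) hg.
have [er eq_] := gram_realify g; rewrite -hg (mx2_eta h) in er eq_.
have dh : h ord0 ord0 * h ord_max ord_max - h ord0 ord_max * h ord_max ord0 = 1.
  by rewrite -det_mx2 -mx2_eta.
move: dh er eq_.
set a := h ord0 ord0; set b := h ord0 ord_max.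
set c := h ord_max ord0; set d := h ord_max ord_max => dh.
have [-> ->] := gram_real_diag a b c d ph => -[er1 er2] [eq1 eq2].
have cd : 0 < c ^+ 2 + d ^+ 2.
  rewrite lt0r addr_ge0 ?sqr_ge0 // andbT; apply/eqP => /eqP.
  rewrite paddr_eq0 ?sqr_ge0 // !sqrf_eq0 => /andP[/eqP c0 /eqP d0].
  by move/eqP: dh; rewrite c0 d0 !mulr0 subr0 eq_sym oner_eq0.
have C0 : 0 < cos (2 * ph) by rewrite cos_gt0_pihalf // -pi4_double.
split; first by rewrite -er1 mulr_gt0.
have -> : shear (realify g) = sin (2 * ph) * (2 * (c * d) / (c ^+ 2 + d ^+ 2)).
  rewrite /shear -er1 -er2 -eq1 -eq2.
  transitivity
    (sin (2 * ph) * (2 * (c * d) * (a * d - b * c) / (c ^+ 2 + d ^+ 2))).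
    by field; rewrite !gt_eqF.
  by rewrite dh mulr1.
rewrite normrM.
have S1 : `|sin (2 * ph)| < 1.
  rewrite -(@ltr_pXn2r _ 2) ?nnegrE ?normr_ge0 ?ler01 // -normrX.
  by rewrite ger0_norm ?sqr_ge0 // sin2cos2 expr1n gtrBl exprn_gt0.
apply: le_lt_trans S1; rewrite ler_piMr ?normr_ge0 //.
rewrite normf_div (gtr0_norm cd) ler_pdivrMr // mul1r ler_norml.
apply/andP; split; rewrite -subr_ge0.
  by rewrite (_ : _ - _ = (c + d) ^+ 2) ?sqr_ge0 //; ring.
by rewrite (_ : _ - _ = (c - d) ^+ 2) ?sqr_ge0 //; ring.
Qed.

Lemma coset_crown_map (g : 'M[R[i]]_2) : SL2C g -> 0 < r1 (realify g) ->
  `|shear (realify g)| < 1 ->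
  exists2 p, parameters p & actC g (@x0 R) = crown_map p.
Proof.
move=> sg r10 hy; have [t [x [th [y [t0 hth hy' gE]]]]] :=
  gram_horo_coord sg r10 hy.
exists (crown_param t x th y); first by apply/parametersP; exists t, x, th, y.
rewrite crown_mapE; apply/eq_coset => //.
by apply: det_crown_lift; rewrite gt_eqF.
Qed.

(** The crown inside X_C, as an explicit open condition on representatives. *)
Lemma crownP (g : 'M[R[i]]_2) : SL2C g ->
  crown (actC g (@x0 R)) <->
    (0 < r1 (realify g) /\ `|shear (realify g)| < 1).
Proof.
move=> sg; split; first exact: crown_gram.
move=> [r10 hy]; have [p pP ->] := coset_crown_map sg r10 hy.
exact: crown_map_in_crown.
Qed.

End Horospherical.


(** * Smoothness of the coordinates and the inverse map *)

Section SmoothCoordinates.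
Variable R : realType.
Local Notation M2 := 'M[R]_2.

(** A smooth map on all triples of matrices which agrees with crown_lift on
    the parameters.  It reads th off the entry (0,0) of H and y off the entry
    (0,1) of Y, so that exponentials of arbitrary matrices do not occur. *)
Definition crown_lift_ext (p : M2 * M2 * M2) : M2 * M2 :=
  let b := p.1.1 in let c := cos (p.1.2 ord0 ord0) in
  let s := sin (p.1.2 ord0 ord0) in let y := p.2 ord0 ord_max in
  (mx2 (b ord0 ord0 * c) (b ord0 ord_max * c - b ord0 ord0 * y * s)
     0 (b ord_max ord_max * c),
   mx2 (b ord0 ord0 * s) (b ord0 ord0 * y * c - b ord0 ord_max * s)
     0 (- (b ord_max ord_max * s))).

Lemma crown_lift_extE t x th y :
  crown_lift_ext (crown_param t x th y) = realify (crown_lift t x th y).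
Proof.
rewrite /crown_lift_ext /realify /crown_lift !map_mx2 /= !mxE /=.
by congr pair; apply: mx2_eq => //; rewrite mulrC.
Qed.

Lemma smooth_crown_lift_ext i : smooth_on setT
  (pair_coord (@mx_coord R 1 1) (@mx_coord R 1 1) i \o crown_lift_ext).
Proof.
have oT : open [set: M2 * M2 * M2] by exact: openT.
have sb j k : smooth_on setT (fun p : M2 * M2 * M2 => p.1.1 j k : R^o).
  apply: (@smooth_entry _ _ _ _ _ (fst \o fst)%FUN) => x.
  by apply: continuous_comp; exact: cvg_fst.
have sH j k : smooth_on setT (fun p : M2 * M2 * M2 => p.1.2 j k : R^o).
  apply: (@smooth_entry _ _ _ _ _ (snd \o fst)%FUN) => x.
  by apply: continuous_comp; [exact: cvg_fst|exact: cvg_snd].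
have sy j k : smooth_on setT (fun p : M2 * M2 * M2 => p.2 j k : R^o).
  by apply: (@smooth_entry _ _ _ _ _ snd) => x; exact: cvg_snd.
have [ssin scos] := @smooth_trig R.
have sc : smooth_on setT (fun p : M2 * M2 * M2 => cos (p.1.2 ord0 ord0) : R^o).
  exact: (smooth_comp1 oT scos _ (sH ord0 ord0)).
have ss : smooth_on setT (fun p : M2 * M2 * M2 => sin (p.1.2 ord0 ord0) : R^o).
  exact: (smooth_comp1 oT ssin _ (sH ord0 ord0)).
by case: i => -[i j]; apply: smooth_mx2;
  do ?[exact: sb|exact: sy|exact: sc|exact: ss|exact: smooth_cst|
       apply: smoothN|apply: smoothB|apply: smoothM|exact: oT].
Qed.

(** shear has a denominator r1, so the second condition is meaningful only
    together with the first. *)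
Definition crown_domain : set (M2 * M2) :=
  [set p | 0 < r1 p] `&` [set p | `|shear p| < 1].

Lemma smooth_gram_entries (U : set (M2 * M2)) : open U ->
  [/\ smooth_on U (@r1 R : _ -> R^o), smooth_on U (@r2 R : _ -> R^o),
      smooth_on U (@q1 R : _ -> R^o) & smooth_on U (@q2 R : _ -> R^o)].
Proof.
move=> oU.
have s1 j k : smooth_on U (fun p : M2 * M2 => p.1 j k : R^o).
  by apply: (@smooth_entry _ _ _ _ _ fst) => x; exact: cvg_fst.
have s2 j k : smooth_on U (fun p : M2 * M2 => p.2 j k : R^o).
  by apply: (@smooth_entry _ _ _ _ _ snd) => x; exact: cvg_snd.
by split; do ?[exact: s1|exact: s2|exact: smooth_cst|exact: oU|
  apply: smoothB|apply: smoothD|apply: smoothM].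
Qed.
Lemma open_r1 : open [set p : M2 * M2 | 0 < r1 p].
Proof.
have oT : open [set: M2 * M2] by exact: openT.
have [s _ _ _] := smooth_gram_entries oT.
have := open_preimage oT (s 0%N) (@open_gt R 0).
by rewrite setTI.
Qed.

Lemma smooth_r1V :
  smooth_on [set p : M2 * M2 | 0 < r1 p] (fun p => (r1 p)^-1 : R^o).
Proof.
have [s _ _ _] := smooth_gram_entries open_r1.
by apply: (smoothV open_r1) => // p /= /gt_eqF ->.
Qed.

Lemma smooth_shear :
  smooth_on [set p : M2 * M2 | 0 < r1 p] (@shear R : _ -> R^o).
Proof.
have [_ s2 s3 s4] := smooth_gram_entries open_r1.
apply: (smoothB open_r1 s4); apply: (smoothM open_r1 s3).
exact: (smoothM open_r1 s2 smooth_r1V).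
Qed.

Lemma open_crown_domain : open crown_domain.
Proof.
have oB : open [set x : R | `|x| < 1].
  have -> : [set x : R | `|x| < 1] = ball (0 : R) 1.
    by apply/seteqP; split=> x; rewrite -ball_normE /= sub0r normrN.
  exact: ball_open.
exact: (open_preimage open_r1 (smooth_shear 0%N) oB).
Qed.

Lemma smooth_coord i : smooth_on crown_domain 
  (pair_coord (pair_coord (@mx_coord R 1 1) (@mx_coord R 1 1))
    (@mx_coord R 1 1) i \o @horo_coord R).
Proof.
have oU := open_crown_domain.
have [s1 s2 s3 s4] := smooth_gram_entries oU.
have pos (p : M2 * M2) : crown_domain p -> 0 < r1 p by case.
have sub : crown_domain `<=` [set p | 0 < r1 p] by move=> p [].
have sV : smooth_on crown_domain (fun p => (r1 p)^-1 : R^o).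
  by move=> k; exact: Ck_sub sub (smooth_r1V k).
have sh : smooth_on crown_domain (@shear R : _ -> R^o).
  by move=> k; exact: Ck_sub sub (smooth_shear k).
have rho0 (p : M2 * M2) : crown_domain p -> 0 < r1 p * r1 p + r2 p * r2 p.
  by move=> /pos r0; rewrite ltr_pwDl ?mulr_gt0 // -expr2 sqr_ge0.
have st : smooth_on crown_domain
    (fun p => Num.sqrt (Num.sqrt (r1 p * r1 p + r2 p * r2 p)) : R^o).
  apply: (smooth_sqrt oU); first by move=> p /rho0; rewrite sqrtr_gt0.
  apply: (smooth_sqrt oU rho0).
  by apply: (smoothD oU); apply: (smoothM oU).
have sT : smooth_on crown_domain
    (fun p => (Num.sqrt (Num.sqrt (r1 p * r1 p + r2 p * r2 p)))^-1 : R^o).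
  by apply: (smoothV oU) => // p /rho0 ?; rewrite gt_eqF // !sqrtr_gt0.
have sTV : smooth_on crown_domain
    (fun p => (Num.sqrt (Num.sqrt (r1 p * r1 p + r2 p * r2 p)))^-1^-1 : R^o).
  by apply: (smoothV oU) => // p /rho0 ?; rewrite gt_eqF // invr_gt0 !sqrtr_gt0.
have sth : smooth_on crown_domain
    (fun p => - (2^-1 * atan (r2 p / r1 p)) : R^o).
  apply: (smoothN oU); apply: (smoothM oU); first exact: smooth_cst.
  apply: (smooth_comp1 oU (@smooth_atan R)) => //.
  exact: (smoothM oU s2 sV).
case: i => [[[i j]|[i j]]|[i j]]; apply: smooth_mx2;
  do ?[exact: smooth_cst|exact: sT|exact: sTV|exact: sth|exact: sh|
    exact: s3|exact: sV|apply: (smoothM oU)|apply: (smoothN oU)].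
Qed.

Lemma horo_coord_gramE (g h : 'M[R[i]]_2) :
  gram g = gram h -> horo_coord (realify g) = horo_coord (realify h).
Proof.
move=> gh; have [] := gram_realify g.
rewrite gh; have [-> ->] := gram_realify h.
by move=> [e1 e2] [e3 e4]; rewrite /horo_coord /shear e1 e2 e3 e4.
Qed.

(** horo_coord evaluated on some representative of the coset; the value does
    not depend on it since horo_coord factors through g g^T. *)
Definition crown_inv (X : set 'M[R[i]]_2) : M2 * M2 * M2 :=
  horo_coord (realify (xget 0 [set g | SL2C g /\ actC g (@x0 R) = X])).

Lemma crown_invE (g : 'M[R[i]]_2) : SL2C g ->
  crown_inv (actC g (@x0 R)) = horo_coord (realify g).
Proof.
move=> sg; apply: horo_coord_gramE.
case: xgetP => [h -> [sh /eq_coset]|/(_ g)]; first exact.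
by case.
Qed.

Lemma crown_inv_crown_map (p : M2 * M2 * M2) :
  parameters p -> crown_inv (crown_map p) = p.
Proof.
move=> /parametersP[t [x [th [y [t0 hth hy ->]]]]].
have sg : SL2C (crown_lift t x th y) by apply: det_crown_lift; rewrite gt_eqF.
rewrite crown_mapE crown_invE //.
by have [] := @horo_coord_gram _ _ t x th y t0 hth erefl.
Qed.

Lemma crown_surj (X : set 'M[R[i]]_2) :
  crown X -> exists2 p, parameters p & X = crown_map p.
Proof.
move=> cX; have [h sh [_ [ph hph <-] XE]] := cX.
have sg := SL2C_real_diag ph sh; rewrite -XE in cX *.
by have [r0 hy] := crown_gram sg cX; exact: coset_crown_map.
Qed.

Lemma subgroupNA_mul (b b' : M2) : subgroupNA b -> subgroupNA b' ->
  subgroupNA (b *m b').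
Proof.
move=> /subgroupNA_P[t [x [t0 ->]]] /subgroupNA_P[t' [x' [t0' ->]]].
apply/subgroupNA_P; exists (t * t'), (t ^+ 2 * x' + x).
split; first exact: mulr_gt0.
by rewrite mul_mx2; apply: mx2_eq; field; rewrite !gt_eqF.
Qed.

End SmoothCoordinates.

Theorem proposition2p1 (R : realType) :
  diffeomorphism (parameter_space R) (crown_space R) (@crown_map R) /\
  equivariant (@subgroupNA R) (@parameters R) (@crown R)
    (@act_parameters R) (@act_crown R) (@crown_map R).
Proof.
have smx := @coordinates_mx R 1 1.
split; last first.
  move=> b p bNA pP; have bpP : parameters (act_parameters b p).
    by case: pP => -[p1 p2] p3; split=> //; split=> //; exact: subgroupNA_mul.
  have E : crown_map (act_parameters b p) = act_crown b (crown_map p).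
    by rewrite /act_crown /crown_map -actC_mul !mulmxA /cplx map_mxM.
  by split=> //; rewrite -E; exact: crown_map_in_crown.
exists (@crown_inv R); split.
- apply: (@smooth_map_lift _ _ _ _ _ _ _ _ _ _ _ _ _ setT openT _ _ _
    (fun p => cplx p.1.1 *m expi p.1.2 *m expi p.2) (@crown_lift_ext R)
    (coordinates_pair smx smx) (@smooth_crown_lift_ext R)).
  + move=> p /parametersP[t [x [th [y [t0 hth hy ->]]]]]; rewrite crown_liftE.
    split=> //; last by rewrite crown_lift_extE.
    by apply: det_crown_lift; rewrite gt_eqF.
  + by move=> p pP; split=> //; exact: crown_map_in_crown.
- apply: (@smooth_map_descend _ _ _ _ _ _ _ _ _ _ _ _ _ _ (@open_crown_domain R)
    _ _ _ (@horo_coord R) (coordinates_pair (coordinates_pair smx smx) smx)).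
  + exact: smooth_coord.
  + move=> _ [h sh [_ [ph hph <-] <-]].
    by exists (cplx h *m expi (mx2 ph 0 0 (- ph))) => //; exact: SL2C_real_diag.
  + by move=> g sg; exact: crownP.
  + move=> g sg gc; rewrite crown_invE //; split=> //.
    have [p pP gE] := crown_surj gc.
    by rewrite -crown_invE // gE crown_inv_crown_map.
- exact: crown_inv_crown_map.
- by move=> X /crown_surj[p pP ->]; rewrite crown_inv_crown_map.
Qed.
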